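(* The set $N_1 \setminus N_2$ is $\mathcal D_2(\mathbf\Pi^0_3)$-complete; that is, $N_1\setminus N_2 \in \mathcal D_2(\mathbf\Pi^0_3)$, and for every set $Y \subseteq \{0,1\}^{\mathbb N}$ with $Y \in \mathcal D_2(\mathbf\Pi^0_3)$ there is a continuous map $f:\{0,1\}^{\mathbb N}\to\mathbb R$ with $f^{-1}(N_1\setminus N_2) = Y$.
   Context: $\{0,1\}^{\mathbb N}$ carries the product of the discrete topology. A set is $\mathbf\Pi^0_3$ if it has the form $\bigcap_{m\in\mathbb N}\bigcup_{n\in\mathbb N}F_{m,n}$ with each $F_{m,n}$ closed; it is in $\mathcal D_2(\mathbf\Pi^0_3)$ if it has the form $A\setminus B$ with $A,B\in\mathbf\Pi^0_3$. For a pointclass $\Gamma$, a set $X\in\Gamma$ is $\Gamma$-complete iff every $Y\subseteq\{0,1\}^{\mathbb N}$ with $Y\in\Gamma$ is a continuous preimage of $X$. For finite binary strings $\alpha,\sigma$ with $|\alpha|\le|\sigma|$, let $d_\alpha(\sigma)$ be the number of $i<|\sigma|-|\alpha|$ such that the initial segment of $\sigma$ of length $i+|\alpha|$ ends with $\alpha$, divided by $|\sigma|$. For $x\in\{0,1\}^{\mathbb N}$ and $a \in \mathbb Z$, $a\,.\,x$ denotes $a+\sum_{n\ge0}x(n)2^{-(n+1)}$, and $x\upharpoonright s=(x(0),\dots,x(s-1))$. A real number $a\,.\,x$ is order-$k$ normal in base $2$ iff for each $\alpha\in\{0,1\}^k$, $\lim_{s\to\infty}d_\alpha(x\upharpoonright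 s)=2^{-k}$. $N_k$ denotes the set of all order-$k$ normal numbers in $[0,1]$. *)

(* Defs.v *)
From mathcomp Require Import all_boot all_order all_algebra.
From mathcomp Require Import all_classical all_reals all_analysis.

Set Implicit Arguments.
Unset Strict Implicit.
Unset Printing Implicit Defensive.

Import Order.TTheory GRing.Theory Num.Theory.
Import numFieldNormedType.Exports.
Local Open Scope classical_set_scope.
Local Open Scope ring_scope.

Definition pointclass := forall T : topologicalType, set (set T).

Definition Pi03 : pointclass := fun T A =>
  exists2 F : nat -> nat -> set T,
    (forall m n, closed (F m n)) & A = \bigcap_m \bigcup_n F m n.

Definition D2 (Gamma : pointclass) : pointclass := fun T X =>
  exists A B : set T, [/\ Gamma T A, Gamma T B & X = A `\` B].

Definition complete_for (Gamma : pointclass) (T : topologicalType)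
    (X : set T) : Prop :=
  Gamma T X /\
  forall Y : set cantor_space, Gamma cantor_space Y ->
    exists2 f : cantor_space -> T, continuous f & f @^-1` X = Y.

(* The bound i < size sigma - size alpha is strict, so an occurrence of alpha
   at the very end of sigma is not counted. *)
Definition density (R : realType) (alpha sigma : seq bool) : R :=
  (\sum_(i < size sigma - size alpha)
     suffix alpha (take (i + size alpha) sigma))%N%:R / (size sigma)%:R.

Definition restr (x : cantor_space) (s : nat) : seq bool := mkseq x s.

Definition binary_real (R : realType) (a : int) (x : cantor_space) : R :=
  a%:~R + limn (series (fun n : nat => (x n : nat)%:R * 2 ^- n.+1 : R)).

Definition digits_normal (R : realType) (k : nat) (x : cantor_space) : Prop :=
  forall alpha : k.-tuple bool,
    density R alpha (restr x s) @[s --> \oo] --> (2 ^- k : R).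

(* Quantifying existentially over the expansions is harmless: a real with two
   binary expansions has both eventually constant, so that for k > 0 neither
   is normal to order k, while every real is normal to order 0. *)
Definition normal_order (R : realType) (k : nat) (r : R) : Prop :=
  exists (a : int) (x : cantor_space),
    r = binary_real R a x /\ digits_normal R k x.

Definition N_ (R : realType) (k : nat) : set R :=
  [set r | r \in `[0, 1] /\ normal_order k r].

(* Main.v *)
Require Import Defs.
From mathcomp Require Import all_boot all_order all_algebra.
From mathcomp Require Import all_classical all_reals all_analysis.
From mathcomp Require Import zify ring lra.
Import Order.TTheory GRing.Theory Num.Theory.
Import numFieldNormedType.Exports.
Local Open Scope classical_set_scope.
Local Open Scope ring_scope.

Set Implicit Arguments.
Unset Strict Implicit.
Unset Printing Implicit Defensive.

(* Upper bound: r lies in N_k iff it has an expansion x such that for every m the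
   block densities of x stay within 2^-k/(m+2) of 2^-k from some stage n on. For
   fixed m and n this is a closed set of x, with compact image in the reals. The
   tolerance being less than 2^-k, no such x is eventually constant, so distinct
   m cannot be witnessed by distinct expansions of the same real.

   Hardness: a Pi03 set A of the Cantor space is {x | h x s --> oo} with h x s
   read off from finitely many digits of x; let k x s be the rank for B. Build a
   sequence out of 4-digit words, normally 1100; the periodic sequence 1100 is
   normal to order 2. At the indices q in [2^s, 2^(s+1)) divisible by 2^(k x s)
   use 1010 instead, and at those divisible by 2^(h x s) use 0000. These index
   sets have density 0 iff the corresponding rank tends to infinity. The word
   0000 spoils order 1, whereas 1010 keeps it and only spoils order 2. Thus the
   sequence is order-1 normal iff x is in A, and order-2 normal iff x is in A
   and in B. *)

(** * Convergence and closed sets in the Cantor space *)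

Definition agree (n : nat) (x y : cantor_space) :=
  forall i, (i < n)%N -> x i = y i.

Lemma nbhs_agree (x : cantor_space) n : \forall y \near x, agree n x y.
Proof.
elim: n => [|n IH]; first by near=> y => i.
have : \forall y \near x, x n = y n.
  apply: (@proj_continuous nat (fun _ => bool) n x).
  by apply: filterS (discrete_set1 _) => b /= ->.
move: IH; apply: filterS2 => y IH xyn i; rewrite ltnS leq_eqVlt.
by case/orP => [/eqP -> //|]; apply: IH.
Unshelve. all: by end_near.
Qed.

Lemma continuous_agree (T : topologicalType) (f : cantor_space -> T) n :
  (forall x y, agree n x y -> f x = f y) -> continuous f.
Proof.
move=> fP x B /nbhs_singleton Bfx.
by apply: filterS (nbhs_agree x n) => y /fP; rewrite /= => <-.
Qed.

Lemma cvg_cantor (T : Type) (F : set_system T) {FF : Filter F}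
    (g : T -> cantor_space) (x : cantor_space) :
  (forall i, \forall t \near F, g t i = x i) -> g @ F --> x.
Proof.
move=> gP; apply/cvg_sup => i A [_ [[B _ <-] Bxi] sBA].
by apply: filterS (gP i) => t gti; apply: sBA; rewrite /= gti.
Qed.

Lemma closed_agree (F : set cantor_space) (x : cantor_space) : closed F ->
  (forall n, exists2 y, F y & agree n x y) -> F x.
Proof.
move=> cF FP.
have /choice[y yP] n : exists y, F y /\ agree n x y.
  by have [y] := FP n; exists y.
apply: (@closed_cvg _ _ \oo _ y F cF); first by apply: nearW => n; case: (yP n).
apply: cvg_cantor => i; exists i.+1 => //= n /= ltin.
by have [_ ->] := yP n.
Qed.

(** * [Pi03] sets as the sets where a rank tends to infinity *)

Lemma ub_nondecreasing_stationary (w : nat -> nat) n :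
  (forall s, w s <= w s.+1)%N -> (forall s, w s <= n)%N ->
  \forall s \near \oo, (w s.+1 <= w s)%N.
Proof.
move=> wS wn.
have exw : exists v, `[< exists s, w s = v >].
  by exists (w 0%N); apply/asboolP; exists 0%N.
have ubw v : `[< exists s, w s = v >] -> (v <= n)%N by move=> /asboolP[s <-].
case: (ex_maxnP exw ubw) => v /asboolP[s0 ws0] vmax.
exists s0 => // s /= s0s.
apply: (leq_trans (vmax _ _)); first by apply/asboolP; exists s.+1.
by rewrite -ws0; apply: (homo_leq (@leqnn) leq_trans wS).
Qed.

(* The event [e x s] is a change at stage [s] of the least index of a closed
   set that still looks possible after reading [s] digits. *)
Lemma sigma02_events (F : nat -> set cantor_space) :
  (forall n, closed (F n)) ->
  exists e : cantor_space -> nat -> bool,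
    (forall s x y, agree s.+1 x y -> e x s = e y s) /\
    (forall x, (\bigcup_n F n) x <-> \forall s \near \oo, ~~ e x s).
Proof.
move=> cF.
pose compat s x n := `[< exists2 y, F n y & agree s x y >].
(* When no index below [s] is compatible, [find] returns [s]; so [w x] grows without bound if [x]
   lies in no [F n]. *)
pose w x s := find (compat s x) (iota 0 s).
have compatS s x n : compat s.+1 x n -> compat s x n.
  move=> /asboolP[y Fy xy]; apply/asboolP; exists y => // i /ltnW; exact: xy.
have agr s x y : agree s x y -> compat s x = compat s y.
  move=> xy; apply/funext => n.
  apply: asbool_equiv_eq; split=> -[z Fz h]; exists z => // i lis.
    by rewrite -xy// h.
  by rewrite xy// h.
have wle x s : (w x s <= s)%N.
  by rewrite -[leqRHS](size_iota 0) find_size.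
have wbefore x s n : (n < w x s)%N -> ~~ compat s x n.
  move=> nw; have := before_find 0%N nw.
  by rewrite nth_iota ?add0n => [->//|]; apply: leq_trans nw _.
have wP x s n : compat s x n -> (w x s <= n)%N.
  by move=> c; rewrite leqNgt; apply/negP => /wbefore; rewrite c.
have wfound x s : (w x s < s)%N -> compat s x (w x s).
  move=> ws; have := @nth_find _ 0%N (compat s x) (iota 0 s).
  by rewrite has_find size_iota -/(w x s) nth_iota// add0n; apply.
have wS x s : (w x s <= w x s.+1)%N.
  case: (ltnP (w x s.+1) s.+1) => [/wfound/compatS/wP //|].
  by apply: leq_trans; apply: ltnW; rewrite ltnS.
exists (fun x s => (w x s < w x s.+1)%N); split.
  move=> s x y xy; rewrite /w (agr _ _ _ xy) (agr s x y)// => i lis.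
  by apply: xy; apply: ltnW.
move=> x; split.
  move=> [n _ Fn].
  have wn s : (w x s <= n)%N by apply: wP; apply/asboolP; exists x.
  have := ub_nondecreasing_stationary (wS x) wn.
  by apply: filterS => s; rewrite -leqNgt.
move=> [s0 _ s0P].
have wc s : (w x (s0 + s) = w x s0)%N.
  elim: s => [|s IH]; first by rewrite addn0.
  apply/eqP; rewrite addnS eqn_leq -{1}IH leqNgt.
  rewrite s0P/=; last by rewrite leq_addr.
  by rewrite -IH wS.
exists (w x s0) => //; apply: closed_agree => // n.
(* The second term makes the stage exceed [w x s0], so that [find] has not returned its default; the
   first makes it at least [n]. *)
pose m := maxn n (w x s0).+1.
suff /asboolP[y Fy xy] : compat (s0 + m)%N x (w x s0).
  exists y => // i lin; apply: xy; apply: leq_trans lin _.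
  by apply: leq_trans (leq_maxl _ _) (leq_addl _ _).
rewrite -(wc m); apply: wfound; rewrite wc.
by apply: leq_trans (leq_maxr _ _) (leq_addl _ _).
Qed.

(* [h x s] is the least [m] whose event fires at stage [s]. *)
Lemma pi03_rank (A : set cantor_space) : Pi03 A ->
  exists h : cantor_space -> nat -> nat,
    (forall s x y, agree s.+1 x y -> h x s = h y s) /\
    (forall x, A x <-> forall m, \forall s \near \oo, (m <= h x s)%N).
Proof.
move=> [F cF ->].
have /choice[e eP] := fun m => sigma02_events (cF m).
(* If no event of index below [s] fires, the rank is [s], which also tends to infinity. *)
exists (fun x s => find (fun m => e m x s) (iota 0 s)); split.
  move=> s x y xy; congr find; apply/funext => m.
  by have [/(_ _ _ _ xy)] := eP m.
move=> x; split.
  move=> xA m.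
  have : \forall s \near \oo, forall i, (i < m)%N -> ~~ e i x s.
    elim: m => [|m IH]; first exact: nearW.
    have [_ /(_ x)[/(_ (xA m I)) + _]] := eP m.
    move: IH; apply: filterS2 => s IH em i; rewrite ltnS leq_eqVlt.
    by case/orP => [/eqP -> //|]; apply: IH.
  move: (nbhs_infty_ge m); apply: filterS2 => s ms H.
  rewrite leqNgt; apply/negP => hm.
  have := nth_find 0%N (a := fun m => e m x s) (s := iota 0 s).
  have ls := leq_trans hm ms.
  by rewrite has_find size_iota ls nth_iota// add0n (negPf (H _ hm)) => /(_ isT).
move=> hP m _; have [_ /(_ x)[_ ]] := eP m; apply.
move: (nbhs_infty_gt m) (hP m.+1); apply: filterS2 => s ms mh.
by have := before_find 0%N mh; rewrite nth_iota// add0n => ->.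
Qed.

(** * Binary expansions: recursion on the first digit, injectivity, continuity *)

Definition shift (x : cantor_space) : cantor_space := fun n => x n.+1.

Definition expansion (R : realType) (x : cantor_space) : R :=
  limn (series (fun n : nat => (x n : nat)%:R * 2 ^- n.+1 : R)).

Section Expansion.
Variable R : realType.
Implicit Types x y : cantor_space.
Local Notation b := (@expansion R).
Local Notation digit := (fun x => (fun n : nat => (x n : nat)%:R * 2 ^- n.+1 : R)).

Lemma digit_ge0 x n : 0 <= digit x n.
Proof. by rewrite mulr_ge0. Qed.

Lemma series_digit_le1 x n : series (digit x) n <= 1.
Proof.
(* The bound 1 - 2^-n, unlike 1, carries through the induction. *)
suff: series (digit x) n <= 1 - 2 ^- n.
  by move/le_trans; apply; rewrite gerBl invr_ge0 exprn_ge0.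
elim: n => [|n IH]; first by rewrite seriesEnat/= big_geq// expr0 invr1 subrr.
rewrite seriesSr; have : digit x n <= 2 ^- n.+1.
  by rewrite /= ler_piMl// ?invr_ge0 ?exprn_ge0// lern1 leq_b1.
have : 2 ^- n.+1 = 2^-1 * 2 ^- n :> R by rewrite exprS invfM.
by move: IH => /=; set u := 2 ^- n; set v := 2 ^- n.+1 => *; lra.
Qed.

Lemma is_cvg_expansion x : cvgn (series (digit x)).
Proof.
apply: nondecreasing_is_cvgn.
  by apply/nondecreasing_seqP => n; rewrite seriesSr lerDl digit_ge0.
by exists 1 => _ [n _ <-]; exact: series_digit_le1.
Qed.

Lemma expansion_ge0 x : 0 <= b x.
Proof.
apply: limr_ge; first exact: is_cvg_expansion.
by apply: nearW => n; rewrite sumr_ge0// => i _; rewrite digit_ge0.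
Qed.

Lemma expansion_le1 x : b x <= 1.
Proof.
apply: limr_le; first exact: is_cvg_expansion.
by apply: nearW => n; exact: series_digit_le1.
Qed.

Lemma expansion_shift x : b x = (x 0%N : nat)%:R / 2 + b (shift x) / 2.
Proof.
apply/cvg_lim => //; rewrite -cvg_shiftS.
have -> : [sequence series (digit x) n.+1]_n =
    (fun n => (x 0%N : nat)%:R / 2 + series (digit (shift x)) n / 2).
  apply/funext => n /=; rewrite !seriesEnat/= big_nat_recl//= expr1.
  congr (_ + _); rewrite mulr_suml; apply: eq_bigr => i _.
  by rewrite /shift [2 ^+ i.+2]exprSr invfM mulrA.
apply: cvgD; first exact: cvg_cst.
by apply: cvgMr_tmp; exact: is_cvg_expansion.
Qed.

Lemma expansion_eq0 x : b x = 0 -> forall n, x n = false.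
Proof.
move=> bx0 n; elim: n x bx0 => [|n IH] x bx0.
  have := expansion_shift x; have := expansion_ge0 (shift x).
  by case: (x 0%N) => //=; rewrite bx0 => *; lra.
apply: (IH (shift x)).
have := expansion_shift x; have := expansion_ge0 (shift x).
have : 0 <= (x 0%N : nat)%:R :> R by [].
by rewrite bx0 => *; lra.
Qed.

Lemma expansion_eq1 x : b x = 1 -> forall n, x n = true.
Proof.
have x01 y : (y 0%N : nat)%:R <= 1 :> R by rewrite lern1 leq_b1.
move=> bx1 n; elim: n x bx1 => [|n IH] x bx1.
  have := expansion_shift x; have := expansion_le1 (shift x).
  by case: (x 0%N) => //=; rewrite bx1 => *; lra.
apply: (IH (shift x)).
have := expansion_shift x; have := expansion_le1 (shift x).
by move: (x01 x); rewrite bx1 => *; lra.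
Qed.

(** Two distinct sequences with the same value are both of this kind. *)
Definition eventually_constant x := exists n c, forall i, (n <= i)%N -> x i = c.

Lemma eventually_constant_shift x :
  eventually_constant (shift x) -> eventually_constant x.
Proof. by move=> [n [c xc]]; exists n.+1, c => -[//|i] /xc. Qed.

Lemma expansion_gt0_lt1 x : ~ eventually_constant x -> 0 < b x < 1.
Proof.
move=> nc; rewrite !lt_neqAle expansion_ge0 expansion_le1 !andbT.
apply/andP; split; apply/eqP.
  by move=> /esym/expansion_eq0 h; apply: nc; exists 0%N, false => i _.
by move=> /expansion_eq1 h; apply: nc; exists 0%N, true => i _.
Qed.

(** The strict bounds 0 < [b x] < 1 against 0 <= [b y] <= 1 leave [a - a'] strictly between -1 and
    1. *)
Lemma expansion_inj_int (a a' : int) x y : ~ eventually_constant x ->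
  a%:~R + b x = a'%:~R + b y -> a = a' /\ b x = b y.
Proof.
move=> /expansion_gt0_lt1/andP[x0 x1] e.
have := expansion_ge0 y; have := expansion_le1 y => y1 y0.
suff aa' : a = a' by split => //; move: e; rewrite aa' => /addrI.
have : (a - a')%:~R < (1 : int)%:~R :> R by rewrite rmorphB/=; lra.
have : (-1 : int)%:~R < (a - a')%:~R :> R by rewrite rmorphB rmorphN/=; lra.
by rewrite !ltr_int; lia.
Qed.

(** Doubling the value turns the first digit into an integer part, which [expansion_inj_int]
    separates from the rest; the later digits follow by induction along [shift]. *)
Lemma expansion_inj x y : ~ eventually_constant x -> b x = b y -> x = y.
Proof.
move=> ncx bxy; apply/funext => n.
elim: n x y ncx bxy => [|n IH] x y ncx bxy;
  have ncs : ~ eventually_constant (shift x) by move/eventually_constant_shift.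
all: have [] := @expansion_inj_int (x 0%N : nat) (y 0%N : nat) _ (shift y) ncs.
- by move: bxy; rewrite (expansion_shift x) (expansion_shift y) -!pmulrn => ?; lra.
- by case: (x 0%N) (y 0%N) => [] [].
- by move: bxy; rewrite (expansion_shift x) (expansion_shift y) -!pmulrn => ?; lra.
- by move=> _ /IH; apply.
Qed.

Lemma expansion_agree n x y : agree n x y -> `|b x - b y| <= 2 ^- n.
Proof.
elim: n x y => [|n IH] x y xy.
  rewrite expr0 invr1 ler_norml.
  have := (expansion_ge0 x, expansion_ge0 y).
  have := (expansion_le1 x, expansion_le1 y).
  by move=> -[? ?] -[? ?]; apply/andP; split; lra.
rewrite (expansion_shift x) (expansion_shift y) xy// opprD addrACA subrr add0r.
rewrite -mulrBl normrM.
rewrite [`|2^-1|]ger0_norm ?invr_ge0// exprSr invfM ler_wpM2r ?invr_ge0//.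
by apply: IH => i lin; apply: xy.
Qed.

Lemma expansion_continuous : continuous (b : cantor_space -> R).
Proof.
move=> x; apply/cvgrPdist_lt => e e0.
have : (fun n => 2^-1 ^+ n : R) @ \oo --> (0 : R).
  by apply: cvg_expr; rewrite ger0_norm ?invr_ge0// invf_lt1// ltr1n.
move=> /cvgrPdist_lt/(_ e e0)[n _ /(_ n (leqnn n))].
rewrite sub0r normrN ger0_norm ?exprn_ge0 ?invr_ge0// exprVn => ne.
apply: filterS (nbhs_agree x n) => y xy.
by apply: le_lt_trans ne; exact: expansion_agree.
Qed.

End Expansion.

(** * Cesaro means of real sequences *)

Lemma sum_ltn n N : (\sum_(i < N) (i < n)%N = minn N n)%N.
Proof.
elim: N => [|N IH]; first by rewrite big_ord0 min0n.
by rewrite big_ord_recr/= IH; case: (ltnP N n) => /=; lia.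
Qed.

Section Mean.
Variable R : realType.
Implicit Types (f g : nat -> R) (l : R).

Definition mean f l := (\sum_(i < n) f i) / n%:R @[n --> \oo] --> l.

Lemma cvg_invn : (n%:R^-1 : R) @[n --> \oo] --> (0 : R).
Proof. by rewrite -cvg_shiftS; exact: cvg_harmonic. Qed.

Lemma cvg_ratio_bounded (u v : nat -> R) C l :
  (forall n, `|u n - v n| <= C) ->
  u n / n%:R @[n --> \oo] --> l -> v n / n%:R @[n --> \oo] --> l.
Proof.
move=> uv ul.
have -> : (fun n => v n / n%:R) =
    (fun n => u n / n%:R - (u n - v n) / n%:R).
  by apply/funext => n; rewrite -mulrBl subKr.
rewrite -[l]subr0; apply: cvgB => //.
have C0 : C / n%:R @[n --> \oo] --> (0 : R).
  by rewrite -[0](mulr0 C); apply: cvgMl_tmp; exact: cvg_invn.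
have NC0 : - (C / n%:R) @[n --> \oo] --> (0 : R).
  by rewrite -[0]oppr0; exact: cvgN.
apply: squeeze_cvgr NC0 C0; apply: nearW => n.
by rewrite -ler_norml normrM [X in _ * X]ger0_norm ?invr_ge0// ler_wpM2r ?invr_ge0.
Qed.

Lemma mean_bounded f g C l :
  (forall n, `|\sum_(i < n) f i - \sum_(i < n) g i| <= C) -> mean f l -> mean g l.
Proof. exact: cvg_ratio_bounded. Qed.

Lemma meanD f g l l' : mean f l -> mean g l' -> mean (fun n => f n + g n) (l + l').
Proof.
move=> fl gl; rewrite /mean; under eq_fun do rewrite big_split mulrDl.
exact: cvgD.
Qed.

Lemma meanZ f a l : mean f l -> mean (fun n => a * f n) (a * l).
Proof.
move=> fl; rewrite /mean; under eq_fun do rewrite -mulr_sumr -mulrA.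
exact: cvgMl_tmp.
Qed.

Lemma meanB f g l l' : mean f l -> mean g l' -> mean (fun n => f n - g n) (l - l').
Proof.
move=> fl /(meanZ (a := -1)) gl; rewrite -[- l']mulN1r.
by under eq_fun do rewrite -[- g _]mulN1r; exact: meanD fl gl.
Qed.

Lemma mean_cst a : mean (fun=> a) a.
Proof.
rewrite /mean -cvg_shiftS; under eq_fun do
  rewrite sumr_const card_ord -[a *+ _]mulr_natr mulfK ?pnatr_eq0//.
exact: cvg_cst.
Qed.

Lemma mean_ltn N : mean (fun i => (i < N)%N%:R) 0.
Proof.
apply: (mean_bounded (C := N%:R) _ (mean_cst (a := 0 : R))) => n.
rewrite big1// sub0r normrN ger0_norm ?sumr_ge0// -natr_sum ler_nat sum_ltn.
exact: geq_minr.
Qed.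

Lemma mean_le0 f g : (forall n, 0 <= f n <= g n) -> mean g 0 -> mean f 0.
Proof.
move=> fg g0; apply: (squeeze_cvgr _ (cvg_cst (0 : R)) g0); apply: nearW => n.
have f0 i : 0 <= f i by case/andP: (fg i).
rewrite divr_ge0 ?sumr_ge0//= ler_wpM2r ?invr_ge0//.
by apply: ler_sum => i _; case/andP: (fg i).
Qed.

(** Shifting changes the partial sum by [f n - f 0] only. *)
Lemma mean_succ f l C : (forall n, `|f n| <= C) ->
  mean f l -> mean (fun n => f n.+1) l.
Proof.
move=> fC; apply: (mean_bounded (C := C + C)) => n.
have -> : \sum_(i < n) f i.+1 = \sum_(i < n) f i + f n - f 0%N.
  have <- : \sum_(i < n.+1) f i = \sum_(i < n) f i + f n by rewrite big_ord_recr.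
  by rewrite big_ord_recl addrC addKr.
rewrite -addrA opprD addrA subrr add0r normrN (le_trans (ler_normB _ _))//.
exact: lerD.
Qed.

Definition block d f (q : nat) : R := \sum_(r < d) f (d * q + r)%N.

Lemma sum_block d f n : \sum_(q < n) block d f q = \sum_(i < d * n) f i.
Proof.
elim: n => [|n IH]; first by rewrite muln0 !big_ord0.
rewrite big_ord_recr/= IH mulnS addnC -!(big_mkord xpredT f) /=.
rewrite [RHS](big_cat_nat _ (n := d * n))//= ?leq_addr//; congr (_ + _).
rewrite -{1}[(d * n)%N]add0n big_addn addKn big_mkord.
by apply: eq_bigr => i _; rewrite addnC.
Qed.

Lemma cvg_muln d : (0 < d)%N -> (fun n => (d * n)%N) @ \oo --> \oo.
Proof.
move=> d0 A [N _ NA]; exists N => // n /= Nn; apply: NA => /=.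
by apply: leq_trans Nn _; rewrite leq_pmull.
Qed.

Lemma cvg_divn d : (0 < d)%N -> (fun n => (n %/ d)%N) @ \oo --> \oo.
Proof.
move=> d0 A [N _ NA]; exists (N * d)%N => // n /= Nn; apply: NA => /=.
by rewrite leq_divRL.
Qed.

(** Partial sums of the blocks are partial sums of [f] at multiples of [d]. From the last multiple
    up to [n] there are fewer than [d] terms, each of size at most 1, which division by [n] makes
    negligible. *)
Lemma mean_block d f l : (0 < d)%N -> (forall n, `|f n| <= 1) ->
  mean (block d f) (d%:R * l) <-> mean f l.
Proof.
move=> d0 f1; have dR : d%:R != 0 :> R by rewrite pnatr_eq0 -lt0n.
split=> [fl|fl]; last first.
  rewrite /mean; under eq_fun do rewrite sum_block.
  have -> : (fun n => (\sum_(i < d * n) f i) / n%:R) =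
      (fun n => d%:R * ((\sum_(i < d * n) f i) / (d * n)%:R)).
    by apply/funext => n; rewrite natrM invfM mulrCA mulVKf// mulrC.
  by apply: cvgMl_tmp; exact: (cvg_comp _ _ (cvg_muln d0) fl).
pose u n := \sum_(q < n %/ d) block d f q.
apply: (@cvg_ratio_bounded u _ d%:R) => [n|].
  have dn : (d * (n %/ d) <= n <= d * (n %/ d) + d)%N.
    by have := divn_eq n d; have := ltn_pmod n d0; lia.
  rewrite /u sum_block.
  rewrite -!(big_mkord xpredT f) /=.
  rewrite [X in _ - X](big_cat_nat _ (n := d * (n %/ d)))//=.
    rewrite opprD addrA subrr add0r normrN (le_trans (ler_norm_sum _ _ _))//.
    rewrite (le_trans (ler_sum _ (fun i _ => f1 i)))//.
    by rewrite sumr_const_nat ler_nat; lia.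
  by case/andP: dn.
have nd : (n %/ d)%:R / n%:R @[n --> \oo] --> (d%:R^-1 : R).
  suff : (d%:R * (n %/ d)%:R) / n%:R @[n --> \oo] --> (1 : R).
    move=> h; rewrite -[d%:R^-1]mulr1.
    under eq_fun do rewrite -[(_ %/ d)%:R](mulKf dR) -mulrA.
    exact: cvgMl_tmp.
  apply: (@cvg_ratio_bounded (fun n => n%:R) _ d%:R).
    move=> n; rewrite {1}(divn_eq n d) natrD natrM mulrC addrAC subrr add0r.
    by rewrite ger0_norm// ler_nat ltnW// ltn_mod.
  rewrite -cvg_shiftS; under eq_fun do rewrite divff ?pnatr_eq0//.
  exact: cvg_cst.
have -> : (fun n => u n / n%:R) =
    (fun n => u n / (n %/ d)%:R * ((n %/ d)%:R / n%:R)); last first.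
  rewrite -[l](mulKf dR) mulrC; apply: cvgM nd.
  exact: (cvg_comp _ _ (cvg_divn d0) fl).
(* For [n < d] the quotient [n %/ d] is 0 and both sides vanish, the sum being empty. *)
apply/funext => n; rewrite /u; have [->|q0] := eqVneq (n %/ d)%N 0%N.
  by rewrite big_ord0 !mul0r.
by rewrite mulrA mulfVK// pnatr_eq0.
Qed.

End Mean.

(** * Block densities as Cesaro means *)

Definition occurs (alpha : seq bool) (x : cantor_space) (i : nat) :=
  mkseq (fun j => x (i + j)%N) (size alpha) == alpha.

Lemma density_restr (R : realType) (alpha : seq bool) (x : cantor_space) s :
  density R alpha (restr x s) =
  (\sum_(i < s - size alpha) (occurs alpha x i)%:R) / s%:R.
Proof.
rewrite /density /restr size_mkseq natr_sum; congr (_ / _).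
apply: eq_bigr => i _; congr (nat_of_bool _)%:R.
have ks : (i + size alpha <= s)%N by have := ltn_ord i; lia.
rewrite suffixE size_takel ?size_mkseq// addnK /occurs; congr (_ == _).
apply: (@eq_from_nth _ false) => [|j].
  by rewrite size_drop size_takel size_mkseq// addKn.
rewrite size_drop size_takel ?size_mkseq// addKn => jk.
rewrite nth_drop nth_take ?ltn_add2l// !nth_mkseq//.
by apply: leq_trans ks; rewrite ltn_add2l.
Qed.

(** The sum in [density] stops [size alpha] places before the end; the at most [size alpha] missing
    terms do not affect the limit. *)
Lemma cvg_density (R : realType) (alpha : seq bool) (x : cantor_space) (l : R) :
  density R alpha (restr x s) @[s --> \oo] --> l <->
  mean (fun i => (occurs alpha x i)%:R : R) l.
Proof.
under eq_fun do rewrite density_restr.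
have bnd n : `|\sum_(i < n) (occurs alpha x i)%:R -
    \sum_(i < n - size alpha) (occurs alpha x i)%:R| <= (size alpha)%:R :> R.
  set o := fun i => (occurs alpha x i)%:R : R.
  rewrite -!(big_mkord xpredT o) (big_cat_nat _ (n := n - size alpha)) ?leq_subr//=.
  rewrite addrAC subrr add0r ger0_norm ?sumr_ge0//.
  apply: (@le_trans _ _ (\sum_(n - size alpha <= i < n) 1)).
    by apply: ler_sum => i _; rewrite lern1 leq_b1.
  by rewrite sumr_const_nat ler_nat; lia.
split; apply: cvg_ratio_bounded; last exact: bnd.
by move=> n; rewrite distrC; exact: bnd.
Qed.

(** * The sets [N_ R k] with [k > 0] are [Pi03] *)

Section Borel.
Variables (R : realType) (k : nat).
Hypothesis k0 : (0 < k)%N.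

(** The word of [k] copies of the opposite digit cannot start at or after position [n]. *)
Lemma density_eventually_constant (x : cantor_space) : eventually_constant x ->
  exists alpha : k.-tuple bool, density R alpha (restr x s) @[s --> \oo] --> (0 : R).
Proof.
move=> [n [c xc]]; exists (nseq_tuple k (~~ c)); apply/cvg_density.
apply: mean_le0 (@mean_ltn R n) => i; rewrite ler0n ler_nat /=.
case: ltnP => [_|/xc xi]; first exact: leq_b1.
rewrite /occurs size_nseq; case: eqP => // /(congr1 (nth c ^~ 0%N)).
by rewrite nth_mkseq// nth_nseq k0 addn0 xi; case: (c).
Qed.

Definition near_normal (m n : nat) : set cantor_space :=
  [set x | forall (alpha : k.-tuple bool) s, (n <= s)%N ->
    `|2 ^- k - density R alpha (restr x s)| <= 2 ^- k / m.+2%:R].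

Lemma pow2V_gt0 : 0 < 2 ^- k :> R.
Proof. by rewrite invr_gt0 exprn_gt0. Qed.

(** At a large stage the density of some word would be below 2^-k / 2, and yet within 2^-k / (m+2)
    <= 2^-k / 2 of 2^-k. *)
Lemma near_normal_not_constant m n x :
  near_normal m n x -> ~ eventually_constant x.
Proof.
move=> xmn /density_eventually_constant[alpha].
have e0 : 0 < 2 ^- k / 2 :> R by rewrite divr_gt0 ?pow2V_gt0.
move=> /cvgrPdist_lt/(_ _ e0)[N _ NP].
have /= := NP (maxn n N) (leq_maxr _ _).
have := xmn alpha _ (leq_maxl n N).
rewrite sub0r normrN => h1 h2.
have : `|2 ^- k - 0 : R| <= `|2 ^- k - density R alpha (restr x (maxn n N))| +
  `|density R alpha (restr x (maxn n N)) - 0|.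
  exact: ler_distD.
rewrite !subr0 (ger0_norm (ltW pow2V_gt0)).
have : 2 ^- k / m.+2%:R <= 2 ^- k / 2 :> R.
  by rewrite (ler_wpM2l (ltW pow2V_gt0))// lef_pV2 ?posrE// ler_nat.
move: h1 h2; set u := `|_|; set v := `|_|; set e := _ / m.+2%:R.
by move=> *; lra.
Qed.

Lemma digits_normalP x :
  digits_normal R k x <-> forall m, exists n, near_normal m n x.
Proof.
split=> [xk m|xk alpha].
  have : \forall s \near \oo, forall alpha : k.-tuple bool,
      `|2 ^- k - density R alpha (restr x s)| <= 2 ^- k / m.+2%:R.
    (* There are finitely many words of length [k], so one stage serves for all of them. *)
    apply: filter_forall => alpha; have /cvgrPdist_le := xk alpha.
    by apply; rewrite divr_gt0 ?pow2V_gt0.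
  by move=> [n _ nP]; exists n => alpha s /nP.
apply/cvgrPdist_le => e e0.
have [m _ /(_ m (leqnn m)) me] : \forall m \near \oo, 2 ^- k / m.+2%:R <= e.
  have : (fun m => 2 ^- k / m.+2%:R : R) @ \oo --> (0 : R).
    rewrite -[0](mulr0 (2 ^- k)); apply: cvgMl_tmp.
    have := @cvg_invn R; rewrite -(cvg_shiftn 2).
    by apply: cvg_trans; apply: near_eq_cvg; apply: nearW => n /=; rewrite addn2.
  move=> /cvgrPdist_le/(_ e e0); apply: filterS => m.
  by rewrite sub0r normrN; apply: le_trans; exact: ler_norm.
have [n nP] := xk m; exists n => // s /= ns.
by apply: le_trans me; exact: nP.
Qed.

Lemma digits_normal_not_constant x :
  digits_normal R k x -> ~ eventually_constant x.
Proof. by move=> /digits_normalP/(_ 0%N)[n /near_normal_not_constant]. Qed.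

(** The density at stage [s] is locally constant in [x], as it depends on the first [s] digits
    only. *)
Lemma near_normal_closed m n : closed (near_normal m n).
Proof.
have -> : near_normal m n =
    \bigcap_(p in [set p : k.-tuple bool * nat | (n <= p.2)%N])
    ((fun x => density R p.1 (restr x p.2)) @^-1`
     [set t | `|2 ^- k - t| <= 2 ^- k / m.+2%:R]).
  apply/seteqP; split=> [x xmn [alpha s] /= ns|x xmn alpha s ns]; first exact: xmn.
  exact: (xmn (alpha, s)).
apply: closed_bigI => -[alpha s] _ /=; apply: preimage_closed; last first.
  apply: (@preimage_closed _ _ (fun t : R => `|2 ^- k - t|) [set e | e <= _]).
    apply: in1W => t; apply: cvg_norm.
    by apply: cvgB; [exact: cvg_cst|exact: cvg_id].
  exact: closed_le.
move=> x _; apply: (@continuous_agree _ _ s) => {}x y xy.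
congr density; apply/eq_in_map => i; rewrite mem_iota add0n => /andP[_].
exact: xy.
Qed.

(** A normal [x] is not eventually constant, so its value lies strictly between 0 and 1; membership
    of [r] in [0, 1] then forces the integer part to be 0. *)
Lemma N_P r : N_ k r <-> exists2 x, digits_normal R k x & expansion R x = r.
Proof.
split=> [[r01 [a [x [rE xk]]]]|[x xk <-]].
  exists x => //; have /digits_normal_not_constant/expansion_gt0_lt1 := xk.
  move=> /(_ R)/andP[x0 x1]; move: r01; rewrite rE in_itv/= /binary_real.
  rewrite -/(expansion R x) => /andP[ax0 ax1].
  suff -> : a = 0 by rewrite add0r.
  have : a%:~R < (1 : int)%:~R :> R by lra.
  have : (-1 : int)%:~R < a%:~R :> R by rewrite rmorphN/=; lra.
  by rewrite !ltr_int; lia.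
split; first by rewrite in_itv/= expansion_ge0 expansion_le1.
by exists 0, x; split => //; rewrite /binary_real add0r.
Qed.

Lemma N_expansion x : N_ k (expansion R x) <-> digits_normal R k x.
Proof.
rewrite N_P; split=> [[y yk yx]|xk]; last by exists x.
by rewrite -(expansion_inj (digits_normal_not_constant yk) yx).
Qed.

Lemma N_Pi03 : Pi03 (@N_ R k).
Proof.
exists (fun m n => expansion R @` near_normal m n) => [m n|].
  apply: compact_closed; first exact: norm_hausdorff.
  apply: continuous_compact; first exact/continuous_subspaceT/expansion_continuous.
  apply: (@subclosed_compact _ _ [set: cantor_space]) => //.
    exact: near_normal_closed.
  exact: cantor_space_compact.
apply/seteqP; split=> r.
  move/N_P => [x /digits_normalP xk <-] m _.
  by have [n] := xk m; exists n => //; exists x.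
(* The expansion found for [m] = 0 serves every [m]: any other witness [y] has the same value, hence
   equals it. *)
move=> rP; have [n0 _ [x x0 xr]] := rP 0%N I; apply/N_P; exists x => //.
apply/digits_normalP => m; have [n _ [y ymn yr]] := rP m I; exists n.
by rewrite (expansion_inj (near_normal_not_constant x0) (etrans xr (esym yr))).
Qed.

End Borel.

(** * Index sets whose density is controlled by a rank *)

(** For [q > 0], [trunc_log 2 q] is the [s] with 2^s <= q < 2^(s+1); the index 0 is always
    selected. *)
Definition sparse (h : nat -> nat) (q : nat) : bool :=
  (2 ^ h (trunc_log 2 q) %| q)%N.

Lemma leq_bool (a b : bool) : (a -> b) -> (a <= b)%N.
Proof. by case: a b => [] [] // /(_ isT). Qed.

Section Sparse.
Variable R : realType.

(** Every block of [d] indices starting at a multiple of [d] contains exactly one multiple. *)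
Lemma mean_dvdn d : (0 < d)%N -> mean (fun q => (d %| q)%N%:R : R) d%:R^-1.
Proof.
move=> d0; apply/(mean_block _ d0) => [n|].
  by rewrite ger0_norm// lern1 leq_b1.
rewrite mulfV ?pnatr_eq0 -?lt0n//.
rewrite (_ : block _ _ = fun=> 1); first exact: mean_cst.
apply/funext => q; rewrite /block (bigD1 (Ordinal d0))//= addn0 dvdn_mulr//.
rewrite big1 ?addr0// => r r0; rewrite dvdn_addr ?dvdn_mulr// gtnNdvd//.
by rewrite lt0n.
Qed.

(** Beyond some 2^s0 all selected indices are multiples of 2^m, so the upper density is at most
    2^-m, for every [m]. *)
Lemma mean_sparse h : (forall m, \forall s \near \oo, (m <= h s)%N) ->
  mean (fun q => (sparse h q)%:R : R) 0.
Proof.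
move=> hoo; apply/cvgrPdist_lt => e e0.
have [m me] : exists m, (2 ^ m)%:R^-1 < e.
  have : (fun n => 2^-1 ^+ n : R) @ \oo --> (0 : R).
    by apply: cvg_expr; rewrite ger0_norm ?invr_ge0// invf_lt1// ltr1n.
  move=> /cvgrPdist_lt/(_ e e0)[n _ /(_ n (leqnn n))].
  rewrite sub0r normrN ger0_norm ?exprn_ge0 ?invr_ge0// exprVn => ne.
  by exists n; rewrite natrX.
have [s0 _ s0P] := hoo m.
have m0 : (0 < 2 ^ m)%N by rewrite expn_gt0.
have := meanD (@mean_ltn R (2 ^ s0)) (mean_dvdn m0); rewrite add0r.
move=> /cvgrPdist_lt/(_ (e - (2 ^ m)%:R^-1)); rewrite subr_gt0 => /(_ me).
apply: filterS => n; rewrite sub0r normrN => near_n.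
rewrite ger0_norm ?divr_ge0 ?sumr_ge0//.
apply: (@le_lt_trans _ _
    ((\sum_(i < n) ((i < 2 ^ s0)%N%:R + (2 ^ m %| i)%N%:R)) / n%:R)).
  rewrite ler_wpM2r ?invr_ge0//; apply: ler_sum => q _.
  rewrite -natrD ler_nat; case: ltnP => [_|sq]; first by case: sparse.
  rewrite add0n; apply: leq_bool; apply: dvdn_trans; apply: dvdn_exp2l.
  by apply: s0P => /=; apply: trunc_log_max.
by move: near_n; rewrite ltr_norml; set S := _ / _ => /andP[? ?]; lra.
Qed.

(** If [h s < m] for a large [s], every multiple of 2^m in [2^s, 2^(s+1)) is selected: roughly
    2^(s-m) of the first 2^(s+1) indices, a fraction bounded away from 0. *)
Lemma mean_sparse_inv h : mean (fun q => (sparse h q)%:R : R) 0 ->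
  forall m, \forall s \near \oo, (m <= h s)%N.
Proof.
move=> h0 m; pose d := (2 ^ m)%N; have d0 : (0 < d)%N by rewrite expn_gt0.
pose c : R := d%:R^-1; have c0 : 0 < c by rewrite invr_gt0 ltr0n.
have e0 : 0 < c / 8 by rewrite divr_gt0.
have [N1 _ N1P] : \forall n \near \oo,
    \sum_(q < n) (sparse h q)%:R <= c / 8 * n%:R :> R.
  move/cvgrPdist_le/(_ _ e0): h0; move: (nbhs_infty_gt 0).
  apply: filterS2 => n n0; rewrite sub0r normrN => /(le_trans (ler_norm _)).
  by rewrite ler_pdivrMr ?ltr0n.
have [N2 _ N2P] : \forall n \near \oo, (c * (7 / 8) * n%:R : R) <=
    \sum_(q < n) (d %| q)%N%:R <= c * (9 / 8) * n%:R.
  move/cvgrPdist_le/(_ _ e0): (mean_dvdn d0); move: (nbhs_infty_gt 0).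
  apply: filterS2 => n n0; rewrite -/c ler_norml => /andP[l1 l2].
  by apply/andP; split; [rewrite -ler_pdivlMr ?ltr0n//|rewrite -ler_pdivrMr ?ltr0n//];
    move: l1 l2; set S := _ / n%:R => *; lra.
exists (maxn N1 N2) => // s /=; rewrite geq_max => /andP[s1 s2].
rewrite leqNgt; apply/negP => hsm.
have s2s : (s <= 2 ^ s)%N by apply/ltnW/ltn_expl.
have ss : (2 ^ s <= 2 ^ s.+1)%N by rewrite leq_exp2l.
have := N1P (2 ^ s.+1)%N (leq_trans s1 (leq_trans s2s ss)).
have /andP[+ _] := N2P (2 ^ s.+1)%N (leq_trans s2 (leq_trans s2s ss)).
have /andP[_ +] := N2P (2 ^ s)%N (leq_trans s2 s2s).
have : \sum_(q < 2 ^ s.+1) (d %| q)%N%:R <=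
    \sum_(q < 2 ^ s) (d %| q)%N%:R + \sum_(q < 2 ^ s.+1) (sparse h q)%:R :> R.
  pose D q : R := (d %| q)%N%:R; pose S q : R := (sparse h q)%:R.
  rewrite -!(big_mkord xpredT D) -(big_mkord xpredT S) /=.
  rewrite (big_cat_nat _ (n := 2 ^ s))//= lerD2l.
  rewrite [leRHS](big_cat_nat _ (n := 2 ^ s))//= -[leLHS]add0r lerD ?sumr_ge0//.
  rewrite big_nat_cond [leRHS]big_nat_cond; apply: ler_sum => q.
  rewrite andbT => sq; rewrite ler_nat; apply: leq_bool.
  rewrite /sparse (trunc_log_eq _ sq)//; apply: dvdn_trans.
  by rewrite dvdn_exp2l// ltnW.
rewrite expnS natrM.
have : 0 < c * (2 ^ s)%:R by rewrite mulr_gt0// ltr0n expn_gt0.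
(* The estimates would give (14/8) c z <= (9/8) c z + (2/8) c z, although c z > 0. *)
set z := (2 ^ s)%:R; set X := \sum_(_ < _) _; set Y := \sum_(_ < _) _.
set Z := \sum_(_ < _) _; move=> *; nra.
Qed.

End Sparse.

(* The concatenation of the words 0000, 1010, 1100 selected by [u] and [v].
   All three end in 0, so no occurrence of 11 straddles two of them. *)
Definition coded (u v : nat -> bool) : cantor_space := fun i =>
  if u (i %/ 4)%N then false
  else if v (i %/ 4)%N then ~~ odd (i %% 4)%N else (i %% 4 < 2)%N.

(** * Frequencies of 1 and 11 in coded sequences; normality of orders 1 and 2 *)

Section Coding.
Variable R : realType.
Implicit Types u v : nat -> bool.

Lemma meanN u l : mean (fun q => (u q)%:R : R) l ->
  mean (fun q => (~~ u q)%:R : R) (1 - l).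
Proof.
move=> ul; have := meanB (mean_cst (a := 1 : R)) ul.
congr (mean _ _); apply/funext => q.
by case: (u q); rewrite ?subrr ?subr0.
Qed.

Lemma meanN0 u :
  mean (fun q => (~~ u q)%:R : R) 1 <-> mean (fun q => (u q)%:R : R) 0.
Proof.
split=> /meanN; rewrite ?subr0// subrr.
by under eq_fun do rewrite negbK.
Qed.

Lemma mean_orb u v : mean (fun q => (u q || v q)%:R : R) 0 <->
  mean (fun q => (u q)%:R : R) 0 /\ mean (fun q => (v q)%:R : R) 0.
Proof.
split=> [uv|[u0 v0]]; last first.
  have := meanD u0 v0; rewrite addr0; apply: mean_le0 => q.
  by rewrite -natrD ler0n ler_nat; case: (u q) (v q) => [] [].
split; apply: mean_le0 uv => q; rewrite ler0n ler_nat;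
  by case: (u q) (v q) => [] [].
Qed.

Lemma coded_digit u v q r : (r < 4)%N -> coded u v (4 * q + r)%N =
  if u q then false else if v q then ~~ odd r else (r < 2)%N.
Proof.
move=> r4.
by rewrite /coded mulnC divnMDl// modnMDl divn_small// modn_small// addn0.
Qed.

(** The words 1010 and 1100 both have two ones and 0000 has none, so only [u] affects the block
    sums. *)
Lemma mean_coded_ones u v : mean (fun i => (coded u v i)%:R : R) (1 / 2) <->
  mean (fun q => (u q)%:R : R) 0.
Proof.
rewrite -meanN0 -(@mean_block R 4)// => [|n]; last first.
  by rewrite ger0_norm// lern1 leq_b1.
have -> : block 4 (fun i => (coded u v i)%:R : R) = fun q => 2 * (~~ u q)%:R.
  apply/funext => q; rewrite /block !big_ord_recl big_ord0 /= !coded_digit//.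
  by case: (u q) (v q) => [] [] /=; ring.
have two : 4%:R * (1 / 2) = 2 * 1 :> R by lra.
rewrite two; split=> [/(meanZ (a := 2^-1))|]; last exact: meanZ.
rewrite mulKf//; congr mean; apply/funext => q; rewrite mulKf//.
Qed.

(** Only the word 1100 contains 11, and exactly once. *)
Lemma mean_coded_pairs u v :
  mean (fun i => (coded u v i && coded u v i.+1)%:R : R) (1 / 4) <->
  mean (fun q => (u q)%:R : R) 0 /\ mean (fun q => (v q)%:R : R) 0.
Proof.
rewrite -mean_orb -meanN0 -(@mean_block R 4)// => [|n]; last first.
  by rewrite ger0_norm// lern1 leq_b1.
have -> : block 4 (fun i => (coded u v i && coded u v i.+1)%:R : R) =
    fun q => (~~ (u q || v q))%:R.
  apply/funext => q; pose F i := (coded u v i && coded u v i.+1)%:R : R.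
  rewrite /block -(big_mkord xpredT (fun r => F (4 * q + r)%N)) /index_iota /=.
  rewrite !big_cons big_nil /F -!addnS.
  have [c0 c1] := (@coded_digit u v q 0 isT, @coded_digit u v q 1 isT).
  (* The pair starting at the fourth digit reaches into the next word, but [c3] makes its first
     digit 0, so that word need not be inspected. *)
  have [c2 c3] := (@coded_digit u v q 2 isT, @coded_digit u v q 3 isT).
  rewrite c0 c1 c2 c3.
  by case: (u q) (v q) => [] [] /=; rewrite ?andbF /=; ring.
have -> : 4%:R * (1 / 4) = 1 :> R by lra.
by [].
Qed.

Lemma occurs1 a (y : cantor_space) i : occurs [:: a] y i = (y i == a).
Proof. by rewrite /occurs /= eqseq_cons andbT addn0. Qed.

Lemma occurs2 a b (y : cantor_space) i :
  occurs [:: a; b] y i = (y i == a) && (y i.+1 == b).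
Proof. by rewrite /occurs /= !eqseq_cons andbT addn0 addn1. Qed.

(** The digit 0 has the complementary frequency, so the condition on 1 suffices. *)
Lemma digits_normal1 (y : cantor_space) : digits_normal R 1 y <->
  mean (fun i => (y i)%:R : R) (1 / 2).
Proof.
split=> [/(_ [tuple true])/cvg_density|y1 alpha].
  rewrite expr1 div1r; congr mean; apply/funext => i.
  by rewrite occurs1; case: (y i).
apply/cvg_density; rewrite expr1 -div1r.
case: alpha => [[|a [|? ?]]//= _].
case: a.
  by move: y1; congr mean; apply/funext => i; rewrite occurs1; case: (y i).
have -> : 1 / 2 = 1 - 1 / 2 :> R by lra.
by move: (meanN y1); congr mean; apply/funext => i; rewrite occurs1; case: (y i).
Qed.

(* The densities of the other three pairs follow linearly from those of 1 and
   11, because every pair beginning with 1 is 10 or 11, and so on. *)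
Lemma digits_normal2 (y : cantor_space) : digits_normal R 2 y <->
  mean (fun i => (y i)%:R : R) (1 / 2) /\
  mean (fun i => (y i && y i.+1)%:R : R) (1 / 4).
Proof.
have q4 : 2 ^- 2 = 1 / 4 :> R by rewrite div1r -natrX.
split=> [y2|[y1 y11] alpha].
  have y11 : mean (fun i => (y i && y i.+1)%:R : R) (1 / 4).
    have /cvg_density := y2 [tuple true; true].
    rewrite q4; congr mean; apply/funext => i.
    by rewrite occurs2; case: (y i) (y i.+1) => [] [].
  split=> //; have /cvg_density := y2 [tuple true; false].
  rewrite q4 => /(meanD y11); have -> : 1 / 4 + 1 / 4 = 1 / 2 :> R by lra.
  congr mean; apply/funext => i.
  by rewrite occurs2; case: (y i) (y i.+1) => [] [] /=; ring.
apply/cvg_density; rewrite q4.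
have y1S : mean (fun i => (y i.+1)%:R : R) (1 / 2).
  by apply: (mean_succ (C := 1)) y1 => n; rewrite ger0_norm// lern1 leq_b1.
have y10 : mean (fun i => (y i)%:R - (y i && y i.+1)%:R : R) (1 / 4).
  by have -> : 1 / 4 = 1 / 2 - 1 / 4 :> R; [lra|exact: meanB].
have y01 : mean (fun i => (y i.+1)%:R - (y i && y i.+1)%:R : R) (1 / 4).
  by have -> : 1 / 4 = 1 / 2 - 1 / 4 :> R; [lra|exact: meanB].
have y00 : mean (fun i => (1 - (y i)%:R) -
    ((y i.+1)%:R - (y i && y i.+1)%:R) : R) (1 / 4).
  have -> : 1 / 4 = (1 - 1 / 2) - 1 / 4 :> R by lra.
  by apply: meanB y01; apply: meanB y1; exact: mean_cst.
case: alpha => [[|a [|b [|? ?]]]//= _].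
case: a b => [] []; [move: y11|move: y10|move: y01|move: y00];
  congr mean; apply/funext => i; rewrite occurs2;
  by case: (y i) (y i.+1) => [] [] /=; ring.
Qed.

End Coding.

(** * The class of the difference and the continuous reduction *)

Theorem theorem1 (R : realType) :
  complete_for (D2 Pi03) (@N_ R 1 `\` @N_ R 2).
Proof.
split; first by exists (@N_ R 1), (@N_ R 2); split => //; exact: N_Pi03.
move=> _ [A [B [/pi03_rank[h [hl hP]] /pi03_rank[k [kl kP]] ->]]].
pose g x := coded (sparse (h x)) (sparse (k x)).
have gc : continuous g.
  move=> x; apply: cvg_cantor => i.
  (* Digit [i] of [g x] depends on the two ranks at the single stage [s = trunc_log 2 (i %/ 4)],
     which are read off from [s.+1] digits of [x]. *)
  have := nbhs_agree x (trunc_log 2 (i %/ 4)).+1; apply: filterS => y xy.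
  by rewrite /g /coded /sparse (hl _ _ _ xy) (kl _ _ _ xy).
have sparseP f : mean (fun q => (sparse f q)%:R : R) 0 <->
    forall m, \forall s \near \oo, (m <= f s)%N.
  by split; [exact: mean_sparse_inv|exact: mean_sparse].
have g1 x : @N_ R 1 (expansion R (g x)) <-> A x.
  by rewrite N_expansion// digits_normal1 mean_coded_ones sparseP hP.
have g2 x : @N_ R 2 (expansion R (g x)) <-> A x /\ B x.
  rewrite N_expansion// digits_normal2 mean_coded_ones mean_coded_pairs !sparseP.
  by rewrite hP kP; tauto.
exists (expansion R \o g) => [x|].
  by apply: continuous_comp; [exact: gc|exact: expansion_continuous].
(* Removing from [A] its intersection with [B] leaves the difference of [A] and [B]. *)
by apply/seteqP; split=> x; rewrite /= /setD /mkset/= g1 g2; tauto.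
Qed.
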